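(* Let $R$ be a commutative ring, $G$ a monoid, and $A$ a $G$-act. There exists an isomorphism of non-unital rings $$\varphi\colon R[G{\int} A]\to R[G]\# A$$ defined by $e_{(a,g)}\mapsto e_g p_a$ for all $a\in A$ and $g\in G$.
   Context: A (left) $G$-act over a monoid $G$ is a set $A$ with an operation $G\times A\to A$ satisfying $(gh)a=g(ha)$ and $1_G a=a$. The action category $G{\int} A$ has object set $A$; its morphisms $a\to b$ are pairs $(a,g)$ with $g\in G$ and $b=ga$; composition is $(ga,h)\circ(a,g)=(a,hg)$. For a small category $\mathcal C$, the category algebra $R[\mathcal C]$ is the free $R$-module with basis elements $e_u$, $u$ a morphism of $\mathcal C$, with $R$-bilinear multiplication given by $e_v e_u=e_{vu}$ if the domain of $v$ equals the codomain of $u$, and $e_ve_u=0$ otherwise. $R[G]$ is the monoid ring, with $R$-basis $\{e_g\mid g\in G\}$, $G$-graded with $R[G]_g=Re_g$. For a $G$-graded ring $S=\bigoplus_{g}S_g$, the smash product $S\# A$ is the free left $S$-module with basis $\{p_a\mid a\in A\}$ and with multiplication the biadditive extension of: $(s_gp_a)(t_hp_b)=(s_gt_h)p_b$ if $hb=a$, and $0$ otherwise, where $g,h\in G$, $s_g\in S_g$, $t_h\in S_h$, $a,b\in A$. A non-unital ring is a ring possibly without identity. *)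

(* Defs.v *)
From HB Require Import structures.
From mathcomp Require Import all_boot all_algebra.
From mathcomp Require Import finmap monalg.

Set Implicit Arguments.
Unset Strict Implicit.
Unset Printing Implicit Defensive.

Import GRing.Theory.

Local Open Scope fset_scope.
Local Open Scope ring_scope.

(* A non-unital ring: its product is the product of the underlying semigroup,
   hence is written (x * y)%g. *)
HB.mixin Record Semigroup_isNonUnitalRing V of Semigroup V & GRing.Zmodule V := {
  nu_mulDl : left_distributive (fun x y : V => (x * y)%g) +%R;
  nu_mulDr : right_distributive (fun x y : V => (x * y)%g) +%R
}.

#[short(type="nonUnitalRingType")]
HB.structure Definition NonUnitalRing :=
  {V of Semigroup V & GRing.Zmodule V & Semigroup_isNonUnitalRing V}.

Definition nonunital_ring_iso (U V : nonUnitalRingType) (f : U -> V) : Prop :=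
  [/\ {morph f : x y / x + y}, {morph f : x y / (x * y)%g} & bijective f].

(* Unlike {malg R[K]}, [freeMod R K] is a left module even when R is trivial. *)
Definition freeMod (R : pzRingType) (K : choiceType) : Type := {malg R[K]}.

HB.instance Definition _ (R : pzRingType) (K : choiceType) :=
  GRing.Zmodule.copy (freeMod R K) {malg R[K]}.

Section FreeMod.
Variables (R : pzRingType) (K : choiceType).
Implicit Types (x y : freeMod R K) (k : K) (r : R).

Definition fscale r x : freeMod R K := [malg k in msupp x => r * x@_k].

Definition fbasis k : freeMod R K := << 1 *g k >>.

Lemma fscaleE r x k : (fscale r x)@_k = r * x@_k.
Proof. by rewrite mcoeffE; case: msuppP; rewrite ?mulr0. Qed.

Lemma freeModP x y : (forall k, x@_k = y@_k) -> x = y.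
Proof. by move=> h; apply/malgP. Qed.

Lemma fcoeffD x y k : (x + y)@_k = x@_k + y@_k.
Proof. exact: mcoeffD. Qed.

Lemma fcoeff_sum (I : Type) (s : seq I) (F : I -> freeMod R K) k :
  (\sum_(i <- s) F i)@_k = \sum_(i <- s) (F i)@_k.
Proof. exact: (raddf_sum (mcoeff k : {malg R[K]} -> R)). Qed.

Fact fscaleA a b x : fscale a (fscale b x) = fscale (a * b) x.
Proof. by apply: freeModP => k; rewrite !fscaleE mulrA. Qed.

Fact fscale1r : left_id 1 fscale.
Proof. by move=> x; apply: freeModP => k; rewrite !fscaleE mul1r. Qed.

Fact fscaleDr : right_distributive fscale +%R.
Proof. by move=> r x y; apply: freeModP => k; rewrite !(fscaleE, fcoeffD) mulrDr. Qed.

Fact fscaleDl x : {morph fscale^~ x : a b / a + b}.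
Proof. by move=> a b; apply: freeModP => k; rewrite !(fscaleE, fcoeffD) mulrDl. Qed.

HB.instance Definition _ :=
  GRing.Zmodule_isLmodule.Build R (freeMod R K)
    fscaleA fscale1r fscaleDr fscaleDl.

Lemma fcoeffZ r x k : (r *: x)@_k = r * x@_k.
Proof. exact: fscaleE. Qed.

Lemma fbasisE r k : r *: fbasis k = << r *g k >>.
Proof. by apply: freeModP => l; rewrite fcoeffZ !mcoeffU mulrnAr mulr1. Qed.

Lemma freeModE x : x = \sum_(k <- msupp x) x@_k *: fbasis k.
Proof.
rewrite [LHS](@monalgE _ _ x); apply: eq_bigr => k _.
by rewrite fbasisE.
Qed.

Lemma freeMod_ind (P : freeMod R K -> Prop) :
  (forall x y, P x -> P y -> P (x + y)) -> P 0 ->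
  (forall r k, P (r *: fbasis k)) -> forall x, P x.
Proof.
by move=> PD P0 PU x; rewrite [x]freeModE; apply: big_ind => // k _; apply: PU.
Qed.

End FreeMod.

Lemma morphD0 (U V : zmodType) (f : U -> V) :
  {morph f : x y / x + y} -> f 0 = 0.
Proof. by move=> fD; apply: (addrI (f 0)); rewrite -fD !addr0. Qed.

Section SumOverSupport.
Variables (K : choiceType) (U V : zmodType) (F : K -> U -> V).
Hypothesis FD : forall k, {morph F k : x y / x + y}.

Let F0 k : F k 0 = 0. Proof. exact: morphD0 (FD k). Qed.

Lemma sum_msuppw (d : {fset K}) (x : {malg U[K]}) : msupp x `<=` d ->
  \sum_(k <- msupp x) F k x@_k = \sum_(k <- d) F k x@_k.
Proof.
by move=> le_d; apply: big_fset_incl => // k _ /mcoeff_outdom ->; apply: F0.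
Qed.

Lemma sum_msuppD :
  {morph (fun x : {malg U[K]} => \sum_(k <- msupp x) F k x@_k) : x y / x + y}.
Proof.
move=> x y; rewrite (sum_msuppw (msuppD_le x y)) (sum_msuppw (fsubsetUl _ (msupp y))).
rewrite (sum_msuppw (fsubsetUr (msupp x) _)) -big_split /=.
by apply: eq_bigr => k _; rewrite mcoeffD FD.
Qed.

Lemma sum_msuppU k u : \sum_(l <- msupp << u *g k >>) F l << u *g k >>@_l = F k u.
Proof. by rewrite (sum_msuppw msuppU_le) big_seq_fset1 mcoeffUU. Qed.

End SumOverSupport.

Section BilinearExtension.
Variables (R : comPzRingType) (K : choiceType) (b : K -> K -> freeMod R K).
Implicit Types x y z : freeMod R K.

Definition bilinear_ext x y : freeMod R K :=
  \sum_(k <- msupp x) \sum_(l <- msupp y) (x@_k * y@_l) *: b k l.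

Let inner_add k l u :
  {morph (fun v : R => (u * v) *: b k l) : v w / v + w}.
Proof. by move=> v w; rewrite mulrDr scalerDl. Qed.

Let outer_add y k :
  {morph (fun u : R => \sum_(l <- msupp y) (u * y@_l) *: b k l) : u v / u + v}.
Proof.
move=> u v; rewrite -big_split; apply: eq_bigr => l _.
by rewrite mulrDl scalerDl.
Qed.

Lemma bilinear_extDl : left_distributive bilinear_ext +%R.
Proof.
move=> x y z.
exact: (sum_msuppD (F := fun k u => \sum_(l <- msupp z) (u * z@_l) *: b k l)
  (outer_add z)).
Qed.

Lemma bilinear_extDr : right_distributive bilinear_ext +%R.
Proof.
move=> x y z; rewrite /bilinear_ext -big_split; apply: eq_bigr => k _.
exact: (sum_msuppD (F := fun l v => (x@_k * v) *: b k l)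
  (fun l => inner_add k l _)).
Qed.

Lemma bilinear_extUU r s k l :
  bilinear_ext (r *: fbasis R k) (s *: fbasis R l) = (r * s) *: b k l.
Proof.
rewrite !fbasisE /bilinear_ext.
rewrite (sum_msuppU (F := fun k u => \sum_(l0 <- msupp << s *g l >>)
  (u * << s *g l >>@_l0) *: b k l0) (outer_add _)).
exact: (sum_msuppU (F := fun l v => (r * v) *: b k l) (fun l => inner_add k l _)).
Qed.

Lemma bilinear_extZl r x y : bilinear_ext (r *: x) y = r *: bilinear_ext x y.
Proof.
rewrite /bilinear_ext.
rewrite (sum_msuppw (F := fun k u => \sum_(l <- msupp y) (u * y@_l) *: b k l)
  (outer_add y) (d := msupp x)); last first.
  apply/fsubsetP => k; rewrite -!mcoeff_neq0 fcoeffZ.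
  by apply: contra_neq => ->; rewrite mulr0.
rewrite scaler_sumr; apply: eq_bigr => k _.
rewrite scaler_sumr; apply: eq_bigr => l _.
by rewrite fcoeffZ scalerA mulrA.
Qed.

Lemma bilinear_extZr r x y : bilinear_ext x (r *: y) = r *: bilinear_ext x y.
Proof.
rewrite /bilinear_ext scaler_sumr; apply: eq_bigr => k _.
rewrite (sum_msuppw (F := fun l v => (x@_k * v) *: b k l)
  (fun l => inner_add k l _) (d := msupp y)); last first.
  apply/fsubsetP => l; rewrite -!mcoeff_neq0 fcoeffZ.
  by apply: contra_neq => ->; rewrite mulr0.
rewrite scaler_sumr; apply: eq_bigr => l _.
by rewrite fcoeffZ scalerA mulrCA.
Qed.

Lemma bilinear_ext0l y : bilinear_ext 0 y = 0.
Proof. exact: morphD0 (fun x x' => bilinear_extDl x x' y). Qed.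

Lemma bilinear_ext0r x : bilinear_ext x 0 = 0.
Proof. exact: morphD0 (bilinear_extDr x). Qed.

Lemma bilinear_extUl k l : bilinear_ext (fbasis R k) (fbasis R l) = b k l.
Proof.
by rewrite -[fbasis R k]scale1r -[fbasis R l]scale1r bilinear_extUU mulr1 scale1r.
Qed.

Lemma bilinear_extA :
  (forall k l m,
    bilinear_ext (fbasis R k) (b l m) = bilinear_ext (b k l) (fbasis R m)) ->
  associative bilinear_ext.
Proof.
move=> bA x y z; elim/freeMod_ind: x => [x x'|| r k].
- by rewrite !bilinear_extDl => -> ->.
- by rewrite !bilinear_ext0l.
rewrite !bilinear_extZl; congr (_ *: _).
elim/freeMod_ind: y => [y y'|| s l].
- by rewrite !(bilinear_extDl, bilinear_extDr) => -> ->.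
- by rewrite !(bilinear_ext0l, bilinear_ext0r).
rewrite !(bilinear_extZl, bilinear_extZr); congr (_ *: _).
elim/freeMod_ind: z => [z z'|| t m].
- by rewrite !bilinear_extDr => -> ->.
- by rewrite !bilinear_ext0r.
by rewrite !bilinear_extZr !bilinear_extUl bA.
Qed.

End BilinearExtension.

(* Composition takes a proof that the two morphisms are composable, and
   [mcomp h], with [h : mdom v = mcod u], is the composite of [v] after [u]. *)
Record smallCat : Type := SmallCat {
  ob : eqType;
  mor : choiceType;
  mdom : mor -> ob;
  mcod : mor -> ob;
  idm : ob -> mor;
  mcomp : forall v u : mor, mdom v = mcod u -> mor;
  mdom_id : forall a, mdom (idm a) = a;
  mcod_id : forall a, mcod (idm a) = a;
  mdom_comp : forall v u (h : mdom v = mcod u), mdom (mcomp h) = mdom u;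
  mcod_comp : forall v u (h : mdom v = mcod u), mcod (mcomp h) = mcod v;
  mcomp_idl : forall u (h : mdom (idm (mcod u)) = mcod u), mcomp h = u;
  mcomp_idr : forall u (h : mdom u = mcod (idm (mdom u))), mcomp h = u;
  mcompA : forall w v u (wv : mdom w = mcod v) (vu : mdom v = mcod u)
    (w_vu : mdom w = mcod (mcomp vu)) (wv_u : mdom (mcomp wv) = mcod u),
    mcomp w_vu = mcomp wv_u
}.

Definition catAlg (R : comPzRingType) (C : smallCat) : Type := freeMod R (mor C).

HB.instance Definition _ (R : comPzRingType) (C : smallCat) :=
  GRing.Lmodule.copy (catAlg R C) (freeMod R (mor C)).

Section CategoryAlgebra.
Variables (R : comPzRingType) (C : smallCat).

Definition catAlg_basis (u : mor C) : catAlg R C := fbasis R u.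

Definition catAlg_basis_mul (v u : mor C) : catAlg R C :=
  if mdom v =P mcod u is ReflectT h then catAlg_basis (mcomp h) else 0.

Definition cat_mul : catAlg R C -> catAlg R C -> catAlg R C :=
  bilinear_ext catAlg_basis_mul.

Fact cat_mulA : associative cat_mul.
Proof.
apply: bilinear_extA => w v u; rewrite /catAlg_basis_mul.
case: eqP => [vu|nvu]; case: eqP => [wv|nwv].
- rewrite !bilinear_extUl /catAlg_basis_mul.
  case: eqP => [w_vu|[]]; last by rewrite mcod_comp.
  case: eqP => [wv_u|[]]; last by rewrite mdom_comp.
  by rewrite (mcompA w_vu wv_u).
- rewrite bilinear_ext0l bilinear_extUl /catAlg_basis_mul.
  by case: eqP => // w_vu; case: nwv; rewrite w_vu mcod_comp.
- rewrite bilinear_ext0r bilinear_extUl /catAlg_basis_mul.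
  by case: eqP => // wv_u; case: nvu; rewrite -wv_u mdom_comp.
- by rewrite bilinear_ext0l bilinear_ext0r.
Qed.

HB.instance Definition _ := isSemigroup.Build (catAlg R C) cat_mulA.

HB.instance Definition _ := Semigroup_isNonUnitalRing.Build (catAlg R C)
  (@bilinear_extDl _ _ catAlg_basis_mul) (@bilinear_extDr _ _ catAlg_basis_mul).

Lemma catAlg_basisM (v u : mor C) (h : mdom v = mcod u) :
  (catAlg_basis v * catAlg_basis u)%g = catAlg_basis (mcomp h).
Proof.
rewrite [LHS]bilinear_extUl /catAlg_basis_mul; case: eqP => [h'|/(_ h)//].
by rewrite (eq_irrelevance h h').
Qed.

Lemma catAlg_basisM0 (v u : mor C) :
  mdom v <> mcod u -> (catAlg_basis v * catAlg_basis u)%g = 0.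
Proof. by move=> h; rewrite [LHS]bilinear_extUl /catAlg_basis_mul; case: eqP. Qed.

End CategoryAlgebra.

HB.mixin Record isAct (G : monoidType) A of Choice A := {
  act : G -> A -> A;
  actM : forall g h a, act (g * h)%g a = act g (act h a);
  act1 : forall a, act 1%g a = a
}.

#[short(type="actType")]
HB.structure Definition Act (G : monoidType) := {A of isAct G A & Choice A}.

Section ActionCategory.
Variables (G : monoidType) (A : actType G).
Implicit Types u v w : A * G.

Definition ac_dom u : A := u.1.
Definition ac_cod u : A := act u.2 u.1.
Definition ac_comp v u (_ : ac_dom v = ac_cod u) : A * G := (u.1, (v.2 * u.2)%g).

Fact ac_cod_id a : ac_cod (a, 1%g) = a.
Proof. exact: act1. Qed.

Fact ac_cod_comp v u (h : ac_dom v = ac_cod u) : ac_cod (ac_comp h) = ac_cod v.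
Proof. by rewrite /ac_cod /= actM -[act u.2 u.1]h. Qed.

Fact ac_comp_idl u (h : ac_dom (ac_cod u, 1%g) = ac_cod u) : ac_comp h = u.
Proof. by case: u h => a g h; rewrite /ac_comp /= mul1g. Qed.

Fact ac_comp_idr u (h : ac_dom u = ac_cod (ac_dom u, 1%g)) : ac_comp h = u.
Proof. by case: u h => a g h; rewrite /ac_comp /= mulg1. Qed.

Fact ac_compA w v u (wv : ac_dom w = ac_cod v) (vu : ac_dom v = ac_cod u)
    (w_vu : ac_dom w = ac_cod (ac_comp vu))
    (wv_u : ac_dom (ac_comp wv) = ac_cod u) :
  ac_comp w_vu = ac_comp wv_u.
Proof. by rewrite /ac_comp /= mulgA. Qed.

Definition actionCat : smallCat :=
  @SmallCat A (A * G)%type ac_dom ac_cod (fun a => (a, 1%g)) ac_comp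
    (fun a => erefl a) ac_cod_id (fun v u h => erefl (ac_dom u)) ac_cod_comp
    ac_comp_idl ac_comp_idr ac_compA.

End ActionCategory.

(* The last three fields say that S is the direct sum of the [homog g]:
   [hcomp s] is the family of homogeneous components of [s], and it is the only
   finitely supported family of homogeneous elements with sum [s]. *)
HB.mixin Record PzRing_isGraded (G : monoidType) S of GRing.PzRing S := {
  homog : G -> {pred S};
  homog_zmod : forall g, zmod_closed (homog g);
  homogM : forall g h (s t : S),
    s \in homog g -> t \in homog h -> s * t \in homog (g * h)%g;
  hcomp : S -> {malg S[G]};
  hcomp_homog : forall s g, (hcomp s)@_g \in homog g;
  hcomp_sum : forall s, s = \sum_(g <- msupp (hcomp s)) (hcomp s)@_g;
  hcomp_uniq : forall s (f : {malg S[G]}), (forall g, f@_g \in homog g) ->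
    s = \sum_(g <- msupp f) f@_g -> hcomp s = f
}.

#[short(type="gradedRingType")]
HB.structure Definition GradedRing (G : monoidType) :=
  {S of PzRing_isGraded G S & GRing.PzRing S}.

Definition monoidRing (R : comPzRingType) (G : monoidType) : Type := freeMod R G.

HB.instance Definition _ (R : comPzRingType) (G : monoidType) :=
  GRing.Lmodule.copy (monoidRing R G) (freeMod R G).

Section MonoidRing.
Variables (R : comPzRingType) (G : monoidType).
Implicit Types (x y : monoidRing R G) (g h : G).

Definition monoidRing_basis g : monoidRing R G := fbasis R g.

Definition mon_mul : monoidRing R G -> monoidRing R G -> monoidRing R G :=
  bilinear_ext (fun g h => monoidRing_basis (g * h)%g).

Fact mon_mulA : associative mon_mul.
Proof. by apply: bilinear_extA => g h k; rewrite !bilinear_extUl mulgA. Qed.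

Fact mon_mul1r : left_id (monoidRing_basis 1%g) mon_mul.
Proof.
move=> x; elim/freeMod_ind: x => [x y hx hy||r g].
- by rewrite /mon_mul bilinear_extDr; congr (_ + _).
- exact: bilinear_ext0r.
- by rewrite /mon_mul bilinear_extZr bilinear_extUl mul1g.
Qed.

Fact mon_mulr1 : right_id (monoidRing_basis 1%g) mon_mul.
Proof.
move=> x; elim/freeMod_ind: x => [x y hx hy||r g].
- by rewrite /mon_mul bilinear_extDl; congr (_ + _).
- exact: bilinear_ext0l.
- by rewrite /mon_mul bilinear_extZl bilinear_extUl mulg1.
Qed.

HB.instance Definition _ := GRing.Zmodule_isPzRing.Build (monoidRing R G)
  mon_mulA mon_mul1r mon_mulr1
  (@bilinear_extDl _ _ _) (@bilinear_extDr _ _ _).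

Lemma monoidRing_basisM g h :
  monoidRing_basis g * monoidRing_basis h = monoidRing_basis (g * h)%g.
Proof. exact: bilinear_extUl. Qed.

Lemma mon_scalerAl (r : R) x y : r *: (x * y) = (r *: x) * y.
Proof. by rewrite [RHS]bilinear_extZl. Qed.

(* R[G]_g is R e_g. *)
Definition mon_homog g : {pred monoidRing R G} :=
  [pred x : monoidRing R G | x == x@_g *: monoidRing_basis g].

Lemma mon_homogP g x :
  reflect (exists r, x = r *: monoidRing_basis g) (x \in mon_homog g).
Proof.
apply: (iffP eqP) => [->|[r ->]]; first by exists x@_g.
by rewrite fbasisE mcoeffUU -fbasisE.
Qed.

Fact mon_homog_zmod g : zmod_closed (mon_homog g).
Proof.
split; first by apply/mon_homogP; exists 0; rewrite scale0r.
move=> x y /mon_homogP[r ->] /mon_homogP[s ->]; apply/mon_homogP.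
by exists (r - s); rewrite scalerBl.
Qed.

Fact mon_homogM g h (x y : monoidRing R G) :
  x \in mon_homog g -> y \in mon_homog h -> x * y \in mon_homog (g * h)%g.
Proof.
move=> /mon_homogP[r ->] /mon_homogP[s ->]; apply/mon_homogP; exists (r * s).
exact: bilinear_extUU.
Qed.

Definition mon_hcomp x : {malg (monoidRing R G)[G]} :=
  [malg g in msupp x => x@_g *: monoidRing_basis g].

Lemma mon_hcompE x g : (mon_hcomp x)@_g = x@_g *: monoidRing_basis g.
Proof. by rewrite mcoeffE; case: msuppP; rewrite ?scale0r. Qed.

Fact mon_hcomp_homog x g : (mon_hcomp x)@_g \in mon_homog g.
Proof. by apply/mon_homogP; exists x@_g; rewrite mon_hcompE. Qed.

Fact mon_hcomp_sum x : x = \sum_(g <- msupp (mon_hcomp x)) (mon_hcomp x)@_g.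
Proof.
rewrite (sum_msuppw (F := fun _ u => u) (fun _ _ _ => erefl) (d := msupp x)).
  by rewrite [LHS]freeModE; apply: eq_bigr => g _; rewrite mon_hcompE.
apply/fsubsetP => g; rewrite -!mcoeff_neq0 mon_hcompE.
by apply: contra_neq => ->; rewrite scale0r.
Qed.

Fact mon_hcomp_uniq x (f : {malg (monoidRing R G)[G]}) :
  (forall g, f@_g \in mon_homog g) ->
  x = \sum_(g <- msupp f) f@_g -> mon_hcomp x = f.
Proof.
move=> fh ->; apply/malgP => g; rewrite mon_hcompE.
have fE h : f@_h = (f@_h)@_h *: monoidRing_basis h by apply/eqP; apply: fh.
rewrite [RHS]fE; congr (_ *: _).
have [gf|/mcoeff_outdom gf] := boolP (g \in msupp f); last first.
  rewrite gf fcoeff_sum big_seq big1 ?mcoeff0 // => h hf.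
  rewrite fE fbasisE mcoeffU; case: eqP => // hg.
  by move: hf; rewrite hg -mcoeff_neq0 gf eqxx.
rewrite fcoeff_sum (big_fsetD1 g) //= big1_fset ?addr0 // => h.
rewrite !inE => /andP[/negPf hg _] _.
by rewrite fE fbasisE mcoeffU hg.
Qed.

HB.instance Definition _ := PzRing_isGraded.Build G (monoidRing R G)
  mon_homog_zmod mon_homogM mon_hcomp_homog mon_hcomp_sum mon_hcomp_uniq.

End MonoidRing.

Section GradedRingTheory.
Variables (G : monoidType) (S : gradedRingType G).
Implicit Types (s t : S) (g h : G).

Lemma hcompD : {morph (@hcomp G S) : s t / s + t}.
Proof.
move=> s t; apply: hcomp_uniq => [g|].
  have [_ hD] := GRing.zmod_closedD (homog_zmod (s := S) g).
  by rewrite mcoeffD hD ?hcomp_homog.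
by rewrite (sum_msuppD (F := fun _ u => u)) // -!hcomp_sum.
Qed.

Lemma hcompU g s : s \in homog g -> hcomp s = << s *g g >>.
Proof.
move=> sg; apply: hcomp_uniq => [h|]; last first.
  by rewrite (sum_msuppU (F := fun _ u => u)).
rewrite mcoeffU; case: eqP => [<-//|_].
by have [] := homog_zmod (s := S) h.
Qed.

End GradedRingTheory.

Definition smash (G : monoidType) (S : gradedRingType G) (A : actType G) : Type :=
  freeMod S A.

HB.instance Definition _ (G : monoidType) (S : gradedRingType G) (A : actType G) :=
  GRing.Lmodule.copy (smash S A) (freeMod S A).

Section SmashProduct.
Variables (G : monoidType) (S : gradedRingType G) (A : actType G).
Implicit Types (x y z : smash S A) (a b c : A) (s t : S) (g h : G).

Definition smash_basis a : smash S A := fbasis S a.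

(* The product of s_g p_a and t_h p_b, for homogeneous s_g and t_h. *)
Definition smash_homog_mul a s b h t : smash S A :=
  if act h b == a then (s * t) *: smash_basis b else 0.

Definition smash_mul x y : smash S A :=
  \sum_(a <- msupp x) \sum_(g <- msupp (hcomp x@_a))
  \sum_(b <- msupp y) \sum_(h <- msupp (hcomp y@_b))
    smash_homog_mul a (hcomp x@_a)@_g b h (hcomp y@_b)@_h.

Let hmulDl a b h t : {morph (fun s => smash_homog_mul a s b h t) : s s' / s + s'}.
Proof.
by move=> s s'; rewrite /smash_homog_mul; case: eqP; rewrite ?addr0 // mulrDl scalerDl.
Qed.

Let hmulDr a s b h : {morph smash_homog_mul a s b h : t t' / t + t'}.
Proof.
by move=> t t'; rewrite /smash_homog_mul; case: eqP; rewrite ?addr0 // mulrDr scalerDl.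
Qed.

Let mul1 a s b t : smash S A :=
  \sum_(h <- msupp (hcomp t)) smash_homog_mul a s b h (hcomp t)@_h.

Let mul2 a s y : smash S A := \sum_(b <- msupp y) mul1 a s b y@_b.

Let mul3 a s y : smash S A :=
  \sum_(g <- msupp (hcomp s)) mul2 a (hcomp s)@_g y.

Let mul1Dr a s b : {morph mul1 a s b : t t' / t + t'}.
Proof.
by move=> t t'; rewrite /mul1 hcompD (sum_msuppD (fun h => hmulDr a s b h)).
Qed.

Let mul1Dl a b t : {morph (fun s => mul1 a s b t) : s s' / s + s'}.
Proof.
by move=> s s'; rewrite /mul1 -big_split; apply: eq_bigr => h _; apply: hmulDl.
Qed.

Let mul2Dr a s : {morph mul2 a s : y y' / y + y'}.
Proof. exact: sum_msuppD (fun b => mul1Dr a s b). Qed.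

Let mul2Dl a y : {morph (fun s => mul2 a s y) : s s' / s + s'}.
Proof.
by move=> s s'; rewrite /mul2 -big_split; apply: eq_bigr => b _; apply: mul1Dl.
Qed.

Let mul3Dl a y : {morph (fun s => mul3 a s y) : s s' / s + s'}.
Proof.
move=> s s'; rewrite /mul3 hcompD.
exact: (sum_msuppD (F := fun _ s => mul2 a s y) (fun _ => mul2Dl a y)).
Qed.

Let mul3Dr a s : {morph mul3 a s : y y' / y + y'}.
Proof.
by move=> y y'; rewrite /mul3 -big_split; apply: eq_bigr => g _; apply: mul2Dr.
Qed.

Fact smash_mulDl : left_distributive smash_mul +%R.
Proof.
move=> x x' y.
exact: (sum_msuppD (F := fun a s => mul3 a s y) (fun a => mul3Dl a y)).
Qed.

Fact smash_mulDr : right_distributive smash_mul +%R.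
Proof.
move=> x y y'; rewrite /smash_mul -big_split; apply: eq_bigr => a _.
exact: mul3Dr.
Qed.

Lemma smash_mulE a g s b h t : s \in homog g -> t \in homog h ->
  smash_mul (s *: smash_basis a) (t *: smash_basis b) =
  if act h b == a then (s * t) *: smash_basis b else 0.
Proof.
move=> sg th; rewrite !fbasisE.
transitivity (mul3 a s << t *g b >>).
  exact: (sum_msuppU (F := fun a s => mul3 a s _) (fun a => mul3Dl a _)).
transitivity (mul2 a s << t *g b >>).
  rewrite /mul3 (hcompU sg).
  exact: (sum_msuppU (F := fun _ s => mul2 a s _) (fun _ => mul2Dl a _)).
transitivity (mul1 a s b t).
  exact: (sum_msuppU (F := fun b t => mul1 a s b t) (fun b => mul1Dr a s b)).
rewrite /mul1 (hcompU th) -[X in if _ then X else _]fbasisE.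
exact: (sum_msuppU (F := fun h t => smash_homog_mul a s b h t)
  (fun h => hmulDr a s b h)).
Qed.

Lemma smash_ind (P : smash S A -> Prop) :
  (forall x y, P x -> P y -> P (x + y)) -> P 0 ->
  (forall g s a, s \in homog g -> P (s *: smash_basis a)) -> forall x, P x.
Proof.
move=> PD P0 PU; apply: freeMod_ind => // s a.
rewrite [s]hcomp_sum scaler_suml; apply: big_ind => // g _.
by apply: PU (hcomp_homog s g).
Qed.

Fact smash_mulA : associative smash_mul.
Proof.
have mul0x y : smash_mul 0 y = 0 by exact: morphD0 (fun x x' => smash_mulDl x x' y).
have mulx0 x : smash_mul x 0 = 0 by exact: morphD0 (smash_mulDr x).
move=> x y z; elim/smash_ind: x => [x x'|| g s a sg].
- by rewrite !smash_mulDl => -> ->.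
- by rewrite !mul0x.
elim/smash_ind: y => [y y'|| h t b th].
- by rewrite !(smash_mulDl, smash_mulDr) => -> ->.
- by rewrite !(mul0x, mulx0).
elim/smash_ind: z => [z z'|| k u c uk].
- by rewrite !smash_mulDr => -> ->.
- by rewrite !mulx0.
rewrite (smash_mulE _ _ th uk) (smash_mulE _ _ sg th).
case: (eqVneq (act k c) b) => [kc|kc]; last first.
  rewrite mulx0; case: ifP => _; last by rewrite mul0x.
  by rewrite (smash_mulE _ _ (homogM _ _ _ _ sg th) uk) (negPf kc).
rewrite (smash_mulE _ _ sg (homogM _ _ _ _ th uk)) actM kc.
case: ifP => _; last by rewrite mul0x.
by rewrite (smash_mulE _ _ (homogM _ _ _ _ sg th) uk) kc eqxx mulrA.
Qed.

HB.instance Definition _ := isSemigroup.Build (smash S A) smash_mulA.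

HB.instance Definition _ := Semigroup_isNonUnitalRing.Build (smash S A)
  smash_mulDl smash_mulDr.

End SmashProduct.

(* Main.v *)
(* The elements e_g p_a form an R-basis of R[G] # A, and the condition h b = a
   under which (s_g p_a) (t_h p_b) can be nonzero says that (a, g) and (b, h) are
   composable in the action category; both products then have label (b, g h). *)

Require Import Defs.
From mathcomp Require Import all_boot all_algebra.
From mathcomp Require Import finmap monalg.

Import GRing.Theory.

Local Open Scope ring_scope.

Section Comparison.
Variables (R : comPzRingType) (G : monoidType) (A : actType G).
Implicit Types (a : A) (g : G) (r : R) (u v : A * G).

Let CA := catAlg R (actionCat A).
Let SM := smash (monoidRing R G) A.
Let e g : monoidRing R G := monoidRing_basis R g.
Let p a : SM := smash_basis (monoidRing R G) a.

(** The coefficient is an explicit argument because [sum_msuppD] derives additivity of a sum over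
    the support from additivity of each term in its coefficient. *)
Definition cat_to_smash_term u r : SM := (r *: e u.2) *: p u.1.

Definition cat_to_smash (x : CA) : SM :=
  \sum_(u <- msupp x) cat_to_smash_term u x@_u.

(** The inverse is built in two layers, since an element of [SM] is a family indexed by [A] whose
    coefficients are themselves families indexed by [G]. *)
Definition smash_to_cat_row a (s : monoidRing R G) : CA :=
  \sum_(g <- msupp s) s@_g *: catAlg_basis R ((a, g) : mor (actionCat A)).

Definition smash_to_cat (y : SM) : CA :=
  \sum_(a <- msupp y) smash_to_cat_row a y@_a.

Lemma cat_to_smash_termD u : {morph cat_to_smash_term u : r s / r + s}.
Proof. by move=> r s; rewrite /cat_to_smash_term !scalerDl. Qed.

Lemma cat_to_smashD : {morph cat_to_smash : x y / x + y}.
Proof. exact: sum_msuppD cat_to_smash_termD. Qed.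

Lemma cat_to_smash0 : cat_to_smash 0 = 0.
Proof. exact: morphD0 cat_to_smashD. Qed.

Lemma cat_to_smashU r u :
  cat_to_smash (r *: fbasis R u) = (r *: e u.2) *: p u.1.
Proof. by rewrite fbasisE; apply: (sum_msuppU cat_to_smash_termD). Qed.

Lemma smash_to_cat_rowD a : {morph smash_to_cat_row a : s t / s + t}.
Proof.
apply: (sum_msuppD (F := fun g r => r *: fbasis R (a, g))) => g r s.
exact: scalerDl.
Qed.

Lemma smash_to_catD : {morph smash_to_cat : x y / x + y}.
Proof. exact: sum_msuppD smash_to_cat_rowD. Qed.

Lemma smash_to_cat0 : smash_to_cat 0 = 0.
Proof. exact: morphD0 smash_to_catD. Qed.

Lemma smash_to_catU r g a :
  smash_to_cat ((r *: e g) *: p a) = r *: fbasis R (a, g).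
Proof.
rewrite [_ *: p a]fbasisE [LHS](sum_msuppU smash_to_cat_rowD).
rewrite [r *: e g]fbasisE.
apply: (sum_msuppU (F := fun g r => r *: fbasis R (a, g))) => h s t.
exact: scalerDl.
Qed.

Lemma cat_to_smashK : cancel cat_to_smash smash_to_cat.
Proof.
elim/freeMod_ind => [x y hx hy|| r [a g]].
- by rewrite cat_to_smashD smash_to_catD hx hy.
- by rewrite cat_to_smash0 smash_to_cat0.
- by rewrite cat_to_smashU smash_to_catU.
Qed.

(** By additivity it is enough to treat homogeneous coefficients, and one of degree [g] is a
    multiple [r *: e g]. *)
Lemma smash_to_catK : cancel smash_to_cat cat_to_smash.
Proof.
elim/smash_ind => [x y hx hy|| g s a /mon_homogP[r ->]].
- by rewrite smash_to_catD cat_to_smashD hx hy.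
- by rewrite smash_to_cat0 cat_to_smash0.
- by rewrite smash_to_catU cat_to_smashU.
Qed.

Lemma cat_to_smashZ r (x : CA) :
  cat_to_smash (r *: x) = (r *: (1 : monoidRing R G)) *: cat_to_smash x.
Proof.
elim/freeMod_ind: x => [x y hx hy|| s u].
- by rewrite scalerDr !cat_to_smashD hx hy scalerDr.
- by rewrite scaler0 cat_to_smash0 scaler0.
(* In [R[G]], [(r *: 1) * (s *: e g) = r *: (1 * (s *: e g)) = (r * s) *: e g]. *)
by rewrite scalerA !cat_to_smashU scalerA -mon_scalerAl mul1r scalerA.
Qed.

(** Each [r *: e g] is homogeneous of degree [g], so [smash_mulE] computes the right-hand product.
    The scalars are kept because the generators in [freeMod_ind] carry them. *)
Lemma cat_to_smashM_basis r s v u :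
  cat_to_smash ((r *: fbasis R v : CA) * (s *: fbasis R u : CA))%g =
  (cat_to_smash (r *: fbasis R v) * cat_to_smash (s *: fbasis R u))%g.
Proof.
have homogZ t g : t *: e g \in homog g by apply/mon_homogP; exists t.
rewrite !cat_to_smashU [RHS](smash_mulE _ _ (homogZ r v.2) (homogZ s u.2)).
rewrite [X in cat_to_smash X]bilinear_extUU /catAlg_basis_mul.
(* Written with [mdom] and [mcod], the test is the one inside [catAlg_basis_mul], so its dependent
   match reduces in each case. *)
case: (@eqP _ (@mdom (actionCat A) v) (@mcod (actionCat A) u)) => [vu|nvu] /=; last first.
  by case: eqP => [vu|_]; [case: nvu | rewrite scaler0 cat_to_smash0].
rewrite (_ : act u.2 u.1 = v.1) // eqxx.
by rewrite cat_to_smashU [_ * _ in RHS]bilinear_extUU.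
Qed.

(** Both products are biadditive, so induction on each factor reduces the claim to scaled basis
    elements. *)
Lemma cat_to_smashM : {morph cat_to_smash : x y / (x * y)%g}.
Proof.
have cat0x (y : CA) : ((0 : CA) * y)%g = 0.
  exact: morphD0 (fun x x' => nu_mulDl x x' y).
have catx0 (x : CA) : (x * (0 : CA))%g = 0 by exact: morphD0 (nu_mulDr x).
have smash0x (y : SM) : ((0 : SM) * y)%g = 0.
  exact: morphD0 (fun x x' => nu_mulDl x x' y).
have smashx0 (x : SM) : (x * (0 : SM))%g = 0 by exact: morphD0 (nu_mulDr x).
move=> x y; elim/freeMod_ind: x => [x x' hx hx'|| r v].
- by rewrite nu_mulDl !cat_to_smashD hx hx' nu_mulDl.
- by rewrite cat0x cat_to_smash0 smash0x.
elim/freeMod_ind: y => [y y' hy hy'|| s u].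
- by rewrite nu_mulDr !cat_to_smashD hy hy' nu_mulDr.
- by rewrite catx0 cat_to_smash0 smashx0.
exact: cat_to_smashM_basis.
Qed.

End Comparison.

(* (r *: 1) *: _ is the action of r : R on R[G] # A through R -> R[G]. *)
Theorem proposition2p14 (R : comPzRingType) (G : monoidType) (A : actType G) :
  exists phi : catAlg R (actionCat A) -> smash (monoidRing R G) A,
    [/\ nonunital_ring_iso phi,
        forall (r : R) (x : catAlg R (actionCat A)),
          phi (r *: x) = (r *: (1 : monoidRing R G)) *: phi x
      & forall (a : A) (g : G),
          phi (catAlg_basis R ((a, g) : mor (actionCat A))) =
          monoidRing_basis R g *: smash_basis (monoidRing R G) a].
Proof.
exists (@cat_to_smash R G A); split.
- split; [exact: cat_to_smashD | exact: cat_to_smashM |].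
  exact: Bijective (@cat_to_smashK R G A) (@smash_to_catK R G A).
- exact: cat_to_smashZ.
(* The scalar [1] is inserted to reach the form that [cat_to_smashU] evaluates. *)
- move=> a g; rewrite -[catAlg_basis R _]scale1r.
  by rewrite [LHS]cat_to_smashU scale1r.
Qed.
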